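(* Define operators of left, middle and right multiplication on $\mathcal{X}$ by $$L_{xayb}(z):=R_{aybz}(x):=M_{xabz}(y):=\Gamma(x,a,y,b,z).$$ Then, for all $x,a,y,b,z\in\mathcal{X}$, the pairs $$(L_{xayb},L_{yaxb}),\qquad (M_{xabz},M_{zabx}),\qquad (R_{aybz},R_{azby})$$ are structural transformations of the Grassmannian geometry $\mathcal{X}$ (that is, structural pairs of transformations between $\mathcal{X}$ and $\mathcal{X}$).
   Context: $\mathbb{B}$ is an associative unital algebra over a commutative unital ring $\mathbb{K}$, $W$ a right $\mathbb{B}$-module, $\mathcal{X}=\mathrm{Gras}_{\mathbb{B}}(W)$ the set of all $\mathbb{B}$-submodules of $W$. The map $\Gamma:\mathcal{X}^5\to\mathcal{X}$ is defined by $$\Gamma(x,a,y,b,z)=\{\omega\in W:\ \exists\,\xi\in x,\alpha\in a,\eta\in y,\beta\in b,\zeta\in z:\ \omega=\zeta+\alpha=\alpha+\eta+\beta=\xi+\beta\}.$$ For two right $\mathbb{B}$-modules $W,W'$ with Grassmannian geometries $(\mathcal{X},\Gamma)$, $(\mathcal{X}',\Gamma')$, a structural (or adjoint) pair of transformations between $\mathcal{X}$ and $\mathcal{X}'$ is a pair of maps $f:\mathcal{X}\to\mathcal{X}'$, $g:\mathcal{X}'\to\mathcal{X}$ such that for all $x,a,y,b,z\in\mathcal{X}$ and $x',a',y',b',z'\in\mathcal{X}'$: $$f\bigl(\Gamma(x,g(a'),y,g(b'),z)\bigr)=\Gamma'(f(x),a',f(y),b',f(z)),$$ $$g\bigl(\Gamma'(x',f(a),y',f(b),z')\bigr)=\Gamma(g(x'),a,g(y'),b,g(z')).$$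 *)

(* Defs.v *)
From mathcomp Require Import all_boot all_algebra.
From mathcomp Require Import boolp classical_sets.

Set Implicit Arguments.
Unset Strict Implicit.
Unset Printing Implicit Defensive.

Import GRing.Theory.
Local Open Scope ring_scope.
Local Open Scope classical_set_scope.

(* A right module over B is a left module over the converse ring B^c: the
   right action of b on w is (b : B^c) *: w.  Rings are taken in pzRingType,
   so that the zero ring is allowed. *)

Record Gras (B : pzRingType) (W : lmodType B^c) := MkGras {
  gras_set :> set W;
  gras_submod : GRing.submod_closed [in gras_set]
}.

Definition Gamma_set (B : pzRingType) (W : lmodType B^c)
    (x a y b z : set W) : set W :=
  [set omega | exists xi alpha eta beta zeta : W,
    [/\ x xi, a alpha, y eta, b beta & z zeta] /\
    [/\ omega = zeta + alpha,
        omega = alpha + eta + beta &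
        omega = xi + beta]].

Section Gamma.
Context {B : pzRingType} {W : lmodType B^c}.
Implicit Types x a y b z : Gras W.

Lemma Gamma_submod x a y b z :
  GRing.submod_closed [in Gamma_set x a y b z].
Proof.
have c0 (u : Gras W) : (u : set W) 0 by case: u => u [/= /set_mem].
have cl (u : Gras W) k v w :
    (u : set W) v -> (u : set W) w -> (u : set W) (k *: v + w).
  by case: u => u [/= _ h] uv uw; apply: set_mem; apply: h; apply: mem_set.
split.
  by apply/mem_set; exists 0, 0, 0, 0, 0; rewrite !addr0; split; split.
move=> k v w /set_mem [xi [al [et [be [ze [[? ? ? ? ?] [e1 e2 e3]]]]]]].
move=> /set_mem [xi' [al' [et' [be' [ze' [[? ? ? ? ?] [e1' e2' e3']]]]]]].
apply/mem_set; exists (k *: xi + xi'), (k *: al + al'), (k *: et + et'),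
  (k *: be + be'), (k *: ze + ze'); split; first by split; apply: cl.
split.
- by rewrite e1 e1' scalerDr addrACA.
- by rewrite e2 e2' !scalerDr addrACA (addrACA (k *: al)).
- by rewrite e3 e3' scalerDr addrACA.
Qed.

Definition Gamma x a y b z : Gras W := MkGras (Gamma_submod x a y b z).

Definition Lop x a y b : Gras W -> Gras W := fun z => Gamma x a y b z.
Definition Mop x a b z : Gras W -> Gras W := fun y => Gamma x a y b z.
Definition Rop a y b z : Gras W -> Gras W := fun x => Gamma x a y b z.

End Gamma.

Definition structural_pair (B : pzRingType) (W W' : lmodType B^c)
    (f : Gras W -> Gras W') (g : Gras W' -> Gras W) : Prop :=
  forall (x a y b z : Gras W) (x' a' y' b' z' : Gras W'),
    f (Gamma x (g a') y (g b') z) = Gamma (f x) a' (f y) b' (f z) /\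
    g (Gamma x' (f a) y' (f b) z') = Gamma (g x') a (g y') b (g z').

(* Main.v *)
Require Import Defs.
From mathcomp Require Import all_boot all_algebra.
From mathcomp Require Import boolp classical_sets.

(* Each multiplication operator is the action f(u) = F[u] on submodules of a
   linear relation F on W, and its proposed adjoint is the action of the
   converse relation.  For any linear relation F between W and W', the image
   maps of F and of its converse form a structural pair: given omega' in
   Gamma'(f x, a', f y, b', f z) with F-preimages xi, eta, zeta of its
   components, omega := xi + zeta - eta is an F-preimage of omega', and
   xi - eta, zeta - eta are F-preimages of the components in a', b'. *)

Set Implicit Arguments.
Unset Strict Implicit.
Unset Printing Implicit Defensive.

Import GRing.Theory.
Local Open Scope ring_scope.
Local Open Scope classical_set_scope.

Definition sub_closed_rel (V V' : zmodType) (F : V -> V' -> Prop) : Prop :=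
  forall v w v' w', F v v' -> F w w' -> F (v - w) (v' - w').

Definition acts_as (B : pzRingType) (W W' : lmodType B^c)
    (f : Gras W -> Gras W') (F : W -> W' -> Prop) : Prop :=
  forall (u : Gras W) (w : W'),
    (f u : set W') w <-> exists2 v, (u : set W) v & F v w.

Section Gras.
Context {B : pzRingType}.

Lemma Gras_eq (W : lmodType B^c) (u v : Gras W) :
  (forall w, (u : set W) w <-> (v : set W) w) -> u = v.
Proof.
case: u v => [u pu] [v pv] /= uv.
have {uv} e : u = v by apply/funext => w; apply/propext.
by subst v; rewrite (Prop_irrelevance pu pv).
Qed.

Lemma Gras0 (W : lmodType B^c) (u : Gras W) : (u : set W) 0.
Proof. by case: u => u [/= /set_mem]. Qed.

Lemma GrasP (W : lmodType B^c) (u : Gras W) k v w :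
  (u : set W) v -> (u : set W) w -> (u : set W) (k *: v + w).
Proof. by case: u => u [/= _ h] uv uw; apply/set_mem/h; apply: mem_set. Qed.

Lemma GrasB (W : lmodType B^c) (u : Gras W) v w :
  (u : set W) v -> (u : set W) w -> (u : set W) (v - w).
Proof. by move=> uv uw; rewrite addrC -scaleN1r; apply: GrasP. Qed.

Lemma GrasN (W : lmodType B^c) (u : Gras W) v :
  (u : set W) v -> (u : set W) (- v).
Proof. by move=> uv; rewrite -sub0r; apply: GrasB => //; apply: Gras0. Qed.

(** Once [w], [al] and [be] are fixed, the three equations determine [xi], [et] and [ze], so only
    two existential witnesses remain. *)
Lemma GammaP (W : lmodType B^c) (x a y b z : Gras W) w :
  (Gamma x a y b z : set W) w <->
  exists al be, [/\ (a : set W) al, (b : set W) be, (x : set W) (w - be),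
    (y : set W) (w - al - be) & (z : set W) (w - al)].
Proof.
split=> [[xi [al [et [be [ze [[hx ha hy hb hz] [e1 e2 e3]]]]]]]|].
  exists al, be; split => //.
  - by rewrite e3 addrK.
  - by rewrite e2 addrAC addrK addrAC subrr add0r.
  - by rewrite e1 addrK.
case=> al [be [ha hb hx hy hz]].
exists (w - be), al, (w - al - be), be, (w - al); split; split=> //.
- by rewrite subrK.
- by rewrite -addrA subrK addrC subrK.
- by rewrite subrK.
Qed.

Lemma Gamma_sym (W : lmodType B^c) (x a y b z : Gras W) :
  Gamma x a y b z = Gamma z b y a x.
Proof.
by apply: Gras_eq => w; split=> /GammaP[al [be [? ? ? ? ?]]];
  apply/GammaP; exists be, al; split=> //; rewrite addrAC.
Qed.

Lemma acts_as_Gamma (W W' : lmodType B^c) (f : Gras W -> Gras W')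
    (g : Gras W' -> Gras W) (F : W -> W' -> Prop) :
  sub_closed_rel F -> acts_as f F -> acts_as g (fun w v => F v w) ->
  forall x y z a' b',
    f (Gamma x (g a') y (g b') z) = Gamma (f x) a' (f y) b' (f z).
Proof.
move=> FB fF gF x y z a' b'; apply: Gras_eq => w'; split.
  move=> /fF[w /GammaP[al [be [/gF[al' ha Fa] /gF[be' hb Fb] hx hy hz]]] Fw].
  apply/GammaP; exists al', be'; split=> //; apply/fF.
  - by exists (w - be) => //; apply: FB.
  - by exists (w - al - be) => //; apply/FB => //; apply: FB.
  - by exists (w - al) => //; apply: FB.
move=> /GammaP[al' [be' [ha hb /fF[xi hx Fx] /fF[et hy Fy] /fF[ze hz Fz]]]].
have Fa : F (xi - et) al'.
  by have := FB _ _ _ _ Fx Fy; rewrite opprB addrA subrK subKr.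
have Fb : F (ze - et) be' by have := FB _ _ _ _ Fz Fy; rewrite subKr.
apply/fF; exists (ze + (xi - et)).
  apply/GammaP; exists (xi - et), (ze - et); split.
  - by apply/gF; exists al'.
  - by apply/gF; exists be'.
  - by rewrite opprB -addrA [xi - et + _]addrA subrK addrC subrK.
  - by rewrite addrK subKr.
  - by rewrite addrK.
(* The witness is read as [ze - (et - xi)], using differences only; on the target side [et - xi]
   goes to [- al'], which turns [w' - al'] into [w']. *)
have := FB _ _ _ _ Fz (FB _ _ _ _ Fy Fx).
by rewrite !opprB [w' - be' + _]addrA subrK (addrC w' (al' - w')) !subrK.
Qed.

(** The hypotheses are stable under exchanging [f] with [g] and [F] with its converse, so the second
    identity is the first one for the converse. *)
Lemma acts_as_structural (W W' : lmodType B^c) (f : Gras W -> Gras W')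
    (g : Gras W' -> Gras W) (F : W -> W' -> Prop) :
  sub_closed_rel F -> acts_as f F -> acts_as g (fun w v => F v w) ->
  structural_pair f g.
Proof.
move=> FB fF gF x a y b z x' a' y' b' z'; split.
  exact: (acts_as_Gamma FB fF gF).
have FB' : sub_closed_rel (fun w v => F v w) by move=> v w v' w' *; apply: FB.
exact: (acts_as_Gamma FB' gF fF).
Qed.

Lemma Lop_structural (W : lmodType B^c) (x a y b : Gras W) :
  structural_pair (Lop x a y b) (Lop y a x b).
Proof.
(* Here [v] is [ze] and [w] is omega, so that [al = w - v] and [et = v - be]. Exchanging [v] and [w]
   swaps [x] with [y] and negates [al]. *)
pose F (v w : W) := (a : set W) (w - v) /\
  exists be, [/\ (b : set W) be, (x : set W) (w - be) & (y : set W) (v - be)].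
apply: (@acts_as_structural _ _ _ _ F).
- move=> v w v' w' [h1 [be [h2 h3 h4]]] [k1 [be' [k2 k3 k4]]].
  split; first by rewrite opprD addrACA -opprD; apply: GrasB.
  exists (be - be'); split; first exact: GrasB.
    by rewrite opprD addrACA -opprD; apply: GrasB.
  by rewrite opprD addrACA -opprD; apply: GrasB.
- move=> u w; split=> [/GammaP[al [be [ha hb hx hy hz]]]|].
    by exists (w - al) => //; split; [rewrite subKr | exists be].
  case=> v uv [ha [be [hb hx hy]]].
  by apply/GammaP; exists (w - v), be; split; rewrite ?subKr.
- move=> u w; split=> [/GammaP[al [be [ha hb hx hy hz]]]|].
    exists (w - al) => //; split; last by exists be.
    by rewrite addrAC subrr sub0r; apply: GrasN.
  case=> v uv [ha [be [hb hx hy]]].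
  apply/GammaP; exists (w - v), be; split; rewrite ?subKr //.
  by rewrite -opprB; apply: GrasN.
Qed.

Lemma Mop_structural (W : lmodType B^c) (x a b z : Gras W) :
  structural_pair (Mop x a b z) (Mop z a b x).
Proof.
(* Here [v] is [et] and [w] is omega. *)
pose F (v w : W) := exists al be, [/\ (a : set W) al, (b : set W) be,
  (x : set W) (w - be), (z : set W) (w - al) & v = w - al - be].
apply: (@acts_as_structural _ _ _ _ F).
- move=> v w v' w' [al [be [h1 h2 h3 h4 ->]]] [al' [be' [k1 k2 k3 k4 ->]]].
  exists (al - al'), (be - be'); split; try exact: GrasB.
  + by rewrite opprD addrACA -opprD; apply: GrasB.
  + by rewrite opprD addrACA -opprD; apply: GrasB.
  + by rewrite (opprD (w' - al')) addrACA -opprD (opprD w') addrACA -opprD.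
- move=> u w; split=> [/GammaP[al [be [ha hb hx hy hz]]]|].
    by exists (w - al - be) => //; exists al, be.
  by case=> v uv [al [be [? ? ? ? e]]]; apply/GammaP; exists al, be; rewrite -e.
- move=> u v; split=> [/GammaP[al [be [ha hb hx hy hz]]]|].
    (* Solving [v = w - al - be] for [w] negates [al] and [be]; then [w - be = v + al] and
       [w - al = v + be], which swaps [x] with [z]. *)
    exists (v - al - be) => //; exists (- al), (- be); rewrite !opprK.
    split; try exact: GrasN.
    + by rewrite subrK.
    + by rewrite addrAC subrK.
    + by rewrite addrAC !subrK.
  case=> w uw [al [be [ha hb hx hz ->]]]; apply/GammaP.
  exists (- al), (- be); rewrite !opprK; split; try exact: GrasN.
  + by rewrite subrK.
  + by rewrite addrAC !subrK.
  + by rewrite addrAC subrK.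
Qed.

Lemma Rop_Lop (W : lmodType B^c) (a y b z : Gras W) :
  Rop a y b z = Lop z b y a.
Proof. by apply/funext => x; apply: Gamma_sym. Qed.

End Gras.

(* B is an associative unital K-algebra, given by its structure map, a ring
   morphism from K to the center of B (algType would force 1 != 0 in B). *)
Theorem theorem2p7 (K : comPzRingType) (B : pzRingType)
    (iota : {rmorphism K -> B})
    (iota_central : forall (k : K) (c : B), GRing.comm (iota k) c)
    (W : lmodType B^c) (x a y b z : Gras W) :
  [/\ structural_pair (Lop x a y b) (Lop y a x b),
      structural_pair (Mop x a b z) (Mop z a b x) &
      structural_pair (Rop a y b z) (Rop a z b y)].
Proof.
split; [exact: Lop_structural | exact: Mop_structural |].
(* The pair becomes [Lop z b y a], [Lop y b z a], an instance of the left case. *)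
by rewrite !Rop_Lop; apply: Lop_structural.
Qed.
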